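(* Let $Q$ be a 2-connected quiver. Then $$\frac{B_{\mu_Q}(q)}{(1-q^{-1})^{\sharp Q_0}}=\frac{A_Q(q)}{1-q^{-1}}.$$
   Context: A quiver $Q=(Q_0,Q_1,s,t)$ consists of finite sets of vertices $Q_0$ and arrows $Q_1$ with source and target maps $s,t:Q_1\to Q_0$. $Q$ is 2-connected if its underlying graph is connected and removing any one edge does not disconnect it. Let $q$ be a prime power and $\mathcal{O}_\alpha=\mathbb{F}_q[t]/(t^\alpha)$. A locally free representation of $Q$ over $\mathcal{O}_\alpha$ of rank $\underline{1}=(1,\dots,1)\in\mathbb{Z}^{Q_0}$ is a collection of free rank one $\mathcal{O}_\alpha$-modules $M_i$ ($i\in Q_0$) and $\mathcal{O}_\alpha$-linear maps $f_a:M_{s(a)}\to M_{t(a)}$ ($a\in Q_1$). It is indecomposable if it is not a direct sum of two nonzero subrepresentations, and absolutely indecomposable if its base change to $\overline{\mathbb{F}_q}[t]/(t^\alpha)$ is indecomposable. $A_{Q,\underline{1},\alpha}(q)$ is the number of isomorphism classes of absolutely indecomposable locally free representations of rank $\underline{1}$ over $\mathbb{F}_q[t]/(t^\alpha)$. $\mu_{Q,\underline{1},\alpha}^{-1}(0)$ is the set of tuples $(x_a,y_a)_{a\in Q_1}$ with $x_a,y_a\in\mathcal{O}_\alpha$ and $\sum_{t(a)=i}x_ay_a-\sum_{s(a)=i}y_ax_a=0$ in $\mathcal{O}_\alpha$ for all $i\in Q_0$, and $\sharp_{\mathbb{F}_q}\mu_{Q,\underline{1},\alpha}^{-1}(0)$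 is its cardinality. With the Euler form $\langle \mathbf{d},\mathbf{e}\rangle=\sum_{i\in Q_0}d_ie_i-\sum_{a\in Q_1}d_{s(a)}e_{t(a)}$ (so $1-\langle\underline{1},\underline{1}\rangle=1-\sharp Q_0+\sharp Q_1$), define $$A_Q(q)=\lim_{\alpha\to+\infty}q^{-\alpha(1-\langle\underline{1},\underline{1}\rangle)}A_{Q,\underline{1},\alpha}(q),\qquad B_{\mu_Q}(q)=\lim_{\alpha\to+\infty}q^{-\alpha(2\sharp Q_1-\sharp Q_0+1)}\,\sharp_{\mathbb{F}_q}\mu_{Q,\underline{1},\alpha}^{-1}(0).$$ For 2-connected $Q$ both limits are known to exist and to be rational functions of $q$ (Wyss). *)

(* Defs.v *)
From HB Require Import structures.
From mathcomp Require Import all_boot all_order all_algebra all_field.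
From mathcomp Require Import all_classical all_reals all_analysis.
Import Order.TTheory GRing.Theory Num.Theory.
Import numFieldNormedType.Exports.

Set Implicit Arguments.
Unset Strict Implicit.
Unset Printing Implicit Defensive.

Local Open Scope ring_scope.

Record quiver := Quiver {
  vertex : finType;
  arrow : finType;
  src : arrow -> vertex;
  tgt : arrow -> vertex }.

Section Connectedness.
Variable Q : quiver.

(* Adjacency in the underlying graph when only the arrows in A are kept. *)
Definition adjacent (A : {set arrow Q}) : rel (vertex Q) := fun i j =>
  [exists a in A, ((src a == i) && (tgt a == j)) ||
                  ((src a == j) && (tgt a == i))].

(* The graph with no vertices is not connected. *)
Definition connected_by (A : {set arrow Q}) : bool :=
  (0 < #|vertex Q|)%N && [forall i, forall j, connect (adjacent A) i j].

Definition two_connected : bool :=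
  connected_by [set: arrow Q] && [forall a, connected_by (~: [set a])].

Definition euler_form (d e : vertex Q -> int) : int :=
  \sum_i d i * e i - \sum_a d (src a) * e (tgt a).

End Connectedness.

Section Representations.
Variables (Q : quiver) (R : comNzRingType).

Record qrep := QRep {
  qspace : vertex Q -> lmodType R;
  qmap : forall a : arrow Q, {linear qspace (src a) -> qspace (tgt a)} }.

Definition free_rank_one (V : lmodType R) : Prop :=
  exists e : V, forall v : V, exists! c : R, v = c *: e.

Definition locally_free_rank_one (M : qrep) : Prop :=
  forall i, free_rank_one (qspace M i).

Definition qrep_iso (M N : qrep) : Prop :=
  exists g : forall i, {linear qspace M i -> qspace N i},
    (forall i, bijective (g i)) /\
    forall a v, g (tgt a) (qmap M a v) = qmap N a (g (src a) v).

Definition subrep (M : qrep) (U : forall i, set (qspace M i)) : Prop :=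
  (forall i, U i 0 /\
     forall (c : R) u v, U i u -> U i v -> U i (c *: u + v)) /\
  forall a v, U (src a) v -> U (tgt a) (qmap M a v).

Definition subrep_nonzero (M : qrep) (U : forall i, set (qspace M i)) : Prop :=
  exists i v, U i v /\ v != 0.

Definition direct_sum_of (M : qrep) (U W : forall i, set (qspace M i)) : Prop :=
  forall i, (forall v, exists u w, [/\ U i u, W i w & v = u + w]) /\
            (forall v, U i v -> W i v -> v = 0).

Definition indecomposable (M : qrep) : Prop :=
  ~ exists U W : forall i, set (qspace M i),
      [/\ subrep U, subrep W, subrep_nonzero U, subrep_nonzero W &
          direct_sum_of U W].

Definition scalar_map (c : R) : R^o -> R^o := fun v => c * v.

Fact scalar_map_is_linear c : linear (scalar_map c).
Proof.
by move=> k u v; rewrite /scalar_map mulrDr; congr (_ + _); exact: mulrCA.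
Qed.

HB.instance Definition _ c :=
  GRing.isLinear.Build R R^o R^o _ (scalar_map c) (scalar_map_is_linear c).

(* The locally free representation of rank (1,...,1) with M_i = R for all i, in
   which the arrow a acts as multiplication by x a. *)
Definition std_rep (x : arrow Q -> R) : qrep :=
  @QRep (fun=> R^o) (fun a => scalar_map (x a)).

Lemma std_rep_locally_free x : locally_free_rank_one (std_rep x).
Proof.
move=> i; exists (1 : R^o) => v; exists v; split; first by rewrite [RHS]mulr1.
by move=> c ->; rewrite [LHS]mulr1.
Qed.

(* These representations exhaust the isomorphism classes of locally free
   representations of rank (1,...,1), so classes can be counted among them. *)
Lemma locally_free_std M :
  locally_free_rank_one M -> exists x : {ffun arrow Q -> R}, qrep_iso (std_rep x) M.
Proof.
move=> Mfree; pose e i := sval (cid (Mfree i)).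
have eP i v : exists! c, v = c *: e i by exact: (svalP (cid (Mfree i))).
have cP i v : exists c : R, v = c *: e i by case: (eP i v) => c []; exists c.
have e_inj i (c d : R) : c *: e i = d *: e i -> c = d.
  by move=> cd; case: (eP i (c *: e i)) => k [_ ku]; rewrite -(ku c) // -(ku d).
pose x a := sval (cid (cP _ (qmap M a (e (src a))))).
have xP a : qmap M a (e (src a)) = x a *: e (tgt a) by exact: (svalP (cid (cP _ _))).
pose g0 i (c : R^o) := c *: e i.
have g0_lin i : linear (g0 i).
  by move=> k u v; rewrite /g0 scalerDl; congr (_ + _); rewrite scalerA.
pose gm i := GRing.isLinear.Build R R^o (qspace M i) _ (g0 i) (g0_lin i).
pose g i : {linear R^o -> qspace M i} := HB.pack (g0 i) (gm i).
exists [ffun a => x a], g; split=> [i|a v] /=.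
  pose h v := sval (cid (cP i v)).
  have hP v : v = h v *: e i by exact: (svalP (cid (cP i v))).
  by exists h => v; [apply: (e_inj i); rewrite -hP | rewrite [RHS]hP].
by rewrite /g0 /scalar_map ffunE linearZ /= xP scalerA mulrC.
Qed.

End Representations.

(* O_alpha = K[t]/(t^alpha), with 'X for the variable t.  The library replaces a
   constant modulus by 'X, so trunc K 0 is K and not the zero ring; only the
   values alpha >= 1 have a meaning. *)
Definition trunc (K : nzRingType) (alpha : nat) := {poly %/ ('X^alpha : {poly K})}.

Section BaseChange.
Variable F : finFieldType.

Definition alg_closure : countClosedFieldType :=
  tag (countable_algebraic_closure F).

Definition to_closure : {rmorphism F -> alg_closure} :=
  sval (tagged (countable_algebraic_closure F)).

(* The extension to O_alpha of the embedding of F in its algebraic closure,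
   acting on coefficients. *)
Definition trunc_ext alpha (x : trunc F alpha) : trunc alg_closure alpha :=
  in_qpoly 'X^alpha (map_poly to_closure (val x)).

Lemma trunc_ext_in alpha (p : {poly F}) :
  trunc_ext (in_qpoly 'X^alpha p) = in_qpoly 'X^alpha (map_poly to_closure p).
Proof.
have modE (K : fieldType) (p' : {poly K}) :
    Pdiv.CommonRing.rmodp p' (mk_monic 'X^alpha) = p' %% 'X^(alpha.-1.+1).
  by rewrite -Pdiv.IdomainMonic.modpE ?monic_mk_monic // mk_monic_Xn.
by apply: val_inj; rewrite /= !modE map_modp map_polyXn modp_id.
Qed.

Fact trunc_ext_is_zmod_morphism alpha : zmod_morphism (@trunc_ext alpha).
Proof. by move=> x y; rewrite /trunc_ext !raddfB. Qed.

Fact trunc_ext_is_monoid_morphism alpha : monoid_morphism (@trunc_ext alpha).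
Proof.
split=> [|x y]; first by rewrite /trunc_ext rmorph1 in_qpoly1.
have -> : x * y = in_qpoly 'X^alpha (val x * val y) by [].
by rewrite trunc_ext_in rmorphM in_qpolyM.
Qed.

HB.instance Definition _ alpha :=
  GRing.isZmodMorphism.Build (trunc F alpha) (trunc alg_closure alpha)
    (@trunc_ext alpha) (@trunc_ext_is_zmod_morphism alpha).
HB.instance Definition _ alpha :=
  GRing.isMonoidMorphism.Build (trunc F alpha) (trunc alg_closure alpha)
    (@trunc_ext alpha) (@trunc_ext_is_monoid_morphism alpha).

End BaseChange.

Section Counting.
Variables (Q : quiver) (F : finFieldType).

(* Extending scalars along a ring morphism R -> S turns the R-module R into S and
   multiplication by x into multiplication by the image of x; here S is the ring
   of truncated polynomials over the algebraic closure of F. *)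
Definition abs_indecomposable alpha (x : arrow Q -> trunc F alpha) : Prop :=
  indecomposable (std_rep (fun a => trunc_ext (x a))).

(* Isomorphism classes of absolutely indecomposable locally free representations
   of rank (1,...,1) over O_alpha, counted on standard representatives. *)
Definition kac_count alpha : nat :=
  #|equivalence_partition
      (fun x y : {ffun arrow Q -> trunc F alpha} =>
         `[< qrep_iso (std_rep x) (std_rep y) >])
      [set x : {ffun arrow Q -> trunc F alpha} | `[< abs_indecomposable x >]]|.

Definition moment_zero alpha :
    {set {ffun arrow Q -> trunc F alpha * trunc F alpha}} :=
  [set z : {ffun arrow Q -> trunc F alpha * trunc F alpha} |
    [forall i, \sum_(a | tgt a == i) (z a).1 * (z a).2
               - \sum_(a | src a == i) (z a).2 * (z a).1 == 0]].

Variable R : realType.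

Definition q_of : R := #|F|%:R.

Definition A_seq (alpha : nat) : R :=
  q_of ^ (- (alpha%:Z * (1 - euler_form (fun _ : vertex Q => 1) (fun _ => 1))))
  * (kac_count alpha)%:R.

Definition B_seq (alpha : nat) : R :=
  q_of ^ (- (alpha%:Z * (2 * #|arrow Q|%:Z - #|vertex Q|%:Z + 1)))
  * #|moment_zero alpha|%:R.

Definition A_limit : R := limn A_seq.
Definition B_limit : R := limn B_seq.

End Counting.

(* Main.v *)
Require Import Defs.
From HB Require Import structures.
From mathcomp Require Import all_boot all_order all_algebra all_field.
From mathcomp Require Import ring lra.
From mathcomp Require Import all_classical all_reals all_analysis.
Import Order.TTheory GRing.Theory Num.Theory.
Import numFieldNormedType.Exports.
Local Open Scope ring_scope.

(** Why the identity holds. Let O = F_q[t]/(t^alpha), let n and m be the numbers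
    of vertices and arrows, and for x in O^m let End(x) be the set of the l in
    O^n with x_a (l_t(a) - l_s(a)) = 0 for all arrows a, that is, the
    endomorphism ring of the representation x. Both sides of the identity come
    from sums of #End(x).

    For fixed x, the moment map equation is linear in y, with matrix the
    transpose of l |-> (x_a (l_t(a) - l_s(a)))_a. As O is a Frobenius algebra, a
    matrix and its transpose have kernels of the expected relative size, so
    #mu^-1(0) = q^(alpha (m - n)) S with S the sum of #End(x) over all x
    (card_moment_zero).

    As O is local, x is absolutely indecomposable if and only if the arrows with
    x_a != 0 connect the vertices (abs_indecomposableP). The isomorphism classes
    are the orbits of n copies of the unit group of O. Counting them on these x
    by Burnside's lemma requires #Aut(x), which is (1 - 1/q) #End(x) because all
    the residues of an endomorphism of a connected x agree (card_isos_connected). So the number of classes is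
    q^(-alpha n) (1 - 1/q)^(1-n) S', with S' the sum of #End(x) over the x with
    connected support (card_kac_count).

    It remains to see that S and S', divided by q^(alpha (m + 1)), have the same
    limit. The normalized S is nondecreasing in alpha (endo_sum_leS).
    Boundedness uses 2-connectedness: removing an arrow a0 leaves the graph
    connected, so an endomorphism is determined by its value at a vertex and its
    differences along the other arrows, and #End(x) is at most
    q^alpha times the product over a != a0 of #Ann(x_a). For a0 with x_a0 of
    maximal valuation M, this improves the product over all arrows by q^(-M),
    which is enough to dominate the normalized S by a power of a convergent
    geometric series (endo_sum_le). A disconnected x has x_a0 = 0 for some a0,
    so M = alpha, and the difference S - S' is negligible
    (disconnected_sum_le). *)

Set Implicit Arguments.
Unset Strict Implicit.
Unset Printing Implicit Defensive.

(** * Truncated polynomial rings *)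

Section TruncatedPolynomials.
Variables (K : fieldType) (N : nat).
Implicit Types x y : trunc K N.+1.

Lemma mk_monic_Xn1 : mk_monic 'X^(N.+1) = 'X^(N.+1) :> {poly K}.
Proof. exact: mk_monic_Xn. Qed.

Lemma coef_in_trunc (p : {poly K}) k :
  (val (in_qpoly 'X^(N.+1) p))`_k = if (k < N.+1)%N then p`_k else 0.
Proof. by rewrite /= mk_monic_Xn1 -Pdiv.RingMonic.take_poly_rmodp coef_take_poly. Qed.

Lemma coef_trunc_ge x k : (N < k)%N -> (val x)`_k = 0.
Proof.
move=> Nk; apply: nth_default; rewrite -ltnS.
apply: leq_trans (size_mk_monic x) _.
by rewrite mk_monic_Xn1 size_polyXn ltnS.
Qed.

Lemma truncP x y : (forall k, (k < N.+1)%N -> (val x)`_k = (val y)`_k) -> x = y.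
Proof.
move=> xy; apply/val_inj/polyP => k; case: (ltnP k N.+1) => [/xy //|Nk].
by rewrite !coef_trunc_ge.
Qed.

Lemma coef_truncM x y k : (k < N.+1)%N -> (val (x * y))`_k = (val x * val y)`_k.
Proof. by move=> kN; rewrite (coef_in_trunc (val x * val y)) kN. Qed.

Lemma coef_truncD x y k : (val (x + y))`_k = (val x)`_k + (val y)`_k.
Proof. by rewrite -coefD. Qed.

Lemma coef_truncB x y k : (val (x - y))`_k = (val x)`_k - (val y)`_k.
Proof. by rewrite -coefB. Qed.

Lemma coef_trunc1 k : (val (1 : trunc K N.+1))`_k = (k == 0)%:R.
Proof. by rewrite -coef1. Qed.

Lemma coef_trunc0 k : (val (0 : trunc K N.+1))`_k = 0.
Proof. exact: coef0. Qed.

Definition residue x : K := (val x)`_0.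

Lemma residueM x y : residue (x * y) = residue x * residue y.
Proof. by rewrite /residue coef_truncM // coef0M. Qed.

(** The ring is local: by Bezout, a polynomial with nonzero constant term is
    invertible modulo a power of 'X. *)
Lemma trunc_inv x : residue x != 0 -> exists y, x * y = 1.
Proof.
rewrite /residue => x0; have : coprimep (val x) ('X^(N.+1)).
  apply: coprimep_expr; rewrite coprimepX.
  by rewrite /root horner_coef0.
case/Bezout_coprimepP => -[u v] /=; rewrite -size_poly_eq1.
case/size_poly1P => c c0 uv.
exists (in_qpoly 'X^(N.+1) (c^-1 *: u)); apply: truncP => k kN.
rewrite coef_truncM // coef_trunc1 -coef1.
have -> : 1 = c^-1 *: (u * val x + v * 'X^(N.+1)) :> {poly K}.
  by rewrite uv -mul_polyC -polyCM mulVf.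
rewrite coefZ coefD coefMXn kN addr0 -coefZ scalerAl mulrC !coefM.
apply: eq_bigr => i _.
by rewrite coef_in_trunc (leq_trans (ltn_ord i)).
Qed.

(** The t-adic valuation, with value N + 1 at 0. *)
Definition ord x : nat := find (fun k => (val x)`_k != 0) (iota 0 N.+1).

Lemma ord_le x : (ord x <= N.+1)%N.
Proof. by rewrite -[leqRHS](size_iota 0) find_size. Qed.

Lemma coef_lt_ord x k : (k < ord x)%N -> (val x)`_k = 0.
Proof.
move=> kx; have := before_find 0%N kx.
by rewrite nth_iota ?(leq_trans kx (ord_le x)) // add0n => /negbFE/eqP.
Qed.

Lemma coef_ord x : (ord x < N.+1)%N -> (val x)`_(ord x) != 0.
Proof.
move=> xN; have := xN; rewrite -[ltnRHS](size_iota 0) -has_find => h.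
by have := nth_find 0%N h; rewrite nth_iota.
Qed.

Lemma ord_eq0 x : (ord x == N.+1) = (x == 0).
Proof.
apply/eqP/eqP => [xN|->].
  by apply: truncP => k kN; rewrite coef_lt_ord ?xN // coef_trunc0.
apply/eqP; rewrite eqn_leq ord_le leqNgt; apply/negP => /coef_ord.
by rewrite coef_trunc0 eqxx.
Qed.

(** The coefficient of degree ord x + ord y in x * y is the product of the two
    lowest coefficients; it cannot vanish if the truncation leaves it in place. *)
Lemma mul_eq0_ord x y : x * y = 0 -> (N.+1 <= ord x + ord y)%N.
Proof.
move=> xy; rewrite leqNgt; apply/negP => lt.
have : (val (x * y))`_(ord x + ord y) = 0 by rewrite xy coef_trunc0.
have lx : (ord x < ord x + (ord y).+1)%N by rewrite addnS ltnS leq_addr.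
rewrite coef_truncM // coefM -addnS (bigD1 (Ordinal lx)) //= addKn big1 ?addr0.
  move/eqP; rewrite mulf_eq0; apply/negP; rewrite negb_or !coef_ord //.
    exact: leq_ltn_trans (leq_addl _ _) lt.
  exact: leq_ltn_trans (leq_addr _ _) lt.
move=> i /eqP/val_eqP /= ix; case: (ltngtP i (ord x)) ix => // ix _.
  by rewrite (@coef_lt_ord x) // mul0r.
rewrite (@coef_lt_ord y) ?mulr0 // ltn_subLR; last by rewrite -ltnS -addnS ltn_ord.
by rewrite ltn_add2r.
Qed.

End TruncatedPolynomials.

(** If the translations tau act on A and shift r by every scalar, then r is
    equidistributed on A. The proof counts the pairs (c, x) with
    r (tau c x) != 0 in both orders. This single count gives the number of units
    of the ring, the proportion of automorphisms among endomorphisms, and the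
    kernel of a nonzero linear form. *)
Lemma card_residue_neq0 (F : finFieldType) (T : finType) (A : {set T}) (r : T -> F)
    (tau : F -> T -> T) :
  (forall c, injective (tau c)) ->
  (forall c x, x \in A -> tau c x \in A) ->
  (forall c x, x \in A -> r (tau c x) = r x + c) ->
  (#|F| * #|[set x in A | (r x != 0)%R]| = #|F|.-1 * #|A|)%N.
Proof.
move=> tau_inj tauA r_tau.
have tau_im c : tau c @: A = A.
  apply/eqP; rewrite eqEcard card_imset ?leqnn ?andbT //.
  by apply/fintype.subsetP => _ /imsetP[x xA ->]; exact: tauA.
have -> : (#|F| * #|[set x in A | (r x != 0)%R]| =
           \sum_(c : F) \sum_(x in A) (r x + c != 0)%R)%N.
  rewrite -sum_nat_const; apply: eq_bigr => c _.
  rewrite -sum1dep_card big_mkcondr -{1}(tau_im c) big_imset /=; last first.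
    by move=> x y _ _; exact: tau_inj.
  by apply: eq_bigr => x xA; rewrite r_tau //; case: (_ == _).
rewrite exchange_big /= mulnC -sum_nat_const; apply: eq_bigr => x _.
rewrite -big_mkcond sum1dep_card -(cardC1 (- r x)); apply: eq_card => c.
by rewrite !inE addrC addr_eq0.
Qed.

Section FiniteTruncated.
Variables (F : finFieldType) (N : nat).
Local Notation O := (trunc F N.+1).
Implicit Types x y : O.

Lemma card_trunc : #|{: O}| = (#|F| ^ N.+1)%N.
Proof. by rewrite card_monic_qpoly ?size_polyXn // ?monicXn. Qed.

Lemma card_ord_ge j : (#|[set x : O | (j <= ord x)%N]| <= #|F| ^ (N.+1 - j))%N.
Proof.
pose f x : {ffun 'I_(N.+1 - j) -> F} := [ffun i : 'I_(N.+1 - j) => (val x)`_(j + i)].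
rewrite -[X in (_ ^ X)%N]card_ord -card_ffun -(card_in_imset (f := f)) ?max_card //.
move=> x y; rewrite !inE => jx jy /ffunP fxy; apply: truncP => k kN.
case: (ltnP k j) => kj; first by rewrite !coef_lt_ord // ?(leq_trans kj).
have kj' : (k - j < N.+1 - j)%N by rewrite ltn_sub2rE.
by have := fxy (Ordinal kj'); rewrite !ffunE /= subnKC.
Qed.

Definition ann x : {set O} := [set y | x * y == 0].

Lemma card_ann x : (#|ann x| <= #|F| ^ ord x)%N.
Proof.
rewrite -[X in (_ ^ X)%N](subKn (ord_le x)).
apply: leq_trans (card_ord_ge _); apply/subset_leq_card/fintype.subsetP => y.
by rewrite !inE leq_subLR => /eqP /mul_eq0_ord.
Qed.

Definition trunc_const (c : F) : O := in_qpoly 'X^(N.+1) c%:P.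

Lemma coef_trunc_const c k : (val (trunc_const c))`_k = if k == 0%N then c else 0.
Proof. by rewrite coef_in_trunc coefC; case: k => //= k; rewrite if_same. Qed.

Lemma residueDC x c : residue (x + trunc_const c) = residue x + c.
Proof. by rewrite /residue coef_truncD coef_trunc_const. Qed.

Lemma card_trunc_unit : #|[set x : O | residue x != 0]| = (#|F|.-1 * #|F| ^ N)%N.
Proof.
have F0 : (0 < #|F|)%N by apply/card_gt0P; exists 0.
apply/eqP; rewrite -(eqn_pmul2l F0) mulnCA -expnS -card_trunc -[#|{: O}|]cardsT.
rewrite -(@card_residue_neq0 F O [set: O] (@residue F N) (fun c x => x + trunc_const c)) //.
- by apply/eqP; congr (_ * _)%N; apply: eq_card => x; rewrite !inE.
- by move=> c; exact: addIr.
- by move=> c x _; exact: residueDC.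
Qed.

End FiniteTruncated.

(** * Indecomposability and connectedness of the support *)

Section Graphs.
Variable Q : quiver.
Implicit Types A : {set arrow Q}.

Lemma connected_by_const A (T : Type) (f : vertex Q -> T) :
  connected_by A -> (forall a, a \in A -> f (src a) = f (tgt a)) ->
  forall i j, f i = f j.
Proof.
move=> /andP[_ /forallP Aconn] fA i j; have /forallP/(_ j) := Aconn i.
case/connectP => p; elim: p i => [i _ -> //|k p IHp i /= /andP[ik kp] lastj].
rewrite -(IHp k kp lastj); case/existsP: ik => a /andP[aA].
by case/orP => /andP[/eqP <- /eqP <-]; rewrite fA.
Qed.

(** S is the component of a vertex that does not reach every other one. *)
Lemma not_connected_cut A : (0 < #|vertex Q|)%N -> ~~ connected_by A ->
  exists S : {set vertex Q}, [/\ exists i, i \in S, exists j, j \notin S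
    & forall a, a \in A -> (src a \in S) = (tgt a \in S)].
Proof.
move=> V0; rewrite /connected_by V0 => /forallPn[i /forallPn[j ij]].
exists [set k | connect (Defs.adjacent A) i k]; split.
- by exists i; rewrite inE connect0.
- by exists j; rewrite inE.
have adjA a : a \in A -> connect (Defs.adjacent A) (src a) (tgt a)
                         /\ connect (Defs.adjacent A) (tgt a) (src a).
  by move=> aA; split; apply/connect1/existsP; exists a;
     rewrite aA !eqxx ?orbT.
move=> a /adjA[st ts]; rewrite !inE; apply/idP/idP => h.
  exact: connect_trans h st.
exact: connect_trans h ts.
Qed.

End Graphs.

Definition support (R : nzRingType) (Q : quiver) (x : arrow Q -> R) : {set arrow Q} :=
  [set a | x a != 0].

Section Indecomposable.
Variables (K : fieldType) (N : nat) (Q : quiver) (x : arrow Q -> trunc K N.+1).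
Local Notation O := (trunc K N.+1).

(** As the ring is local, one of the two components of 1 at each vertex is a
    unit, so one summand is everything there and the other is zero. The summand
    that is everything cannot change along an arrow acting by a nonzero scalar. *)
Lemma indecomposable_connected :
  connected_by (support x) -> indecomposable (std_rep x).
Proof.
move=> xconn [U [W [[Umod Umap] [Wmod Wmap] [i [u [Uu u0]]] [j [w [Ww w0]]] UW]]].
have UZ k (c v : O) : U k v -> U k (c * v).
  by move=> Uv; have [U0 UL] := Umod k; have := UL c v 0 Uv U0; rewrite addr0.
have WZ k (c v : O) : W k v -> W k (c * v).
  by move=> Wv; have [W0 WL] := Wmod k; have := WL c v 0 Wv W0; rewrite addr0.
have UorW k : U k (1 : O) \/ W k (1 : O).
  have [u' [w' [Uu' Ww' uw]]] := (UW k).1 (1 : O).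
  have : residue (u' : O) + residue (w' : O) = 1.
    by rewrite /residue -coef_truncD -[_ + _]uw coef_trunc1.
  case: (eqVneq (residue (u' : O)) 0) => [-> | ru _].
    rewrite add0r => rw; have : residue (w' : O) != 0 by rewrite rw oner_neq0.
    by case/trunc_inv => c <-; right; rewrite mulrC; exact: WZ.
  by case: (trunc_inv ru) => c <-; left; rewrite mulrC; exact: UZ.
pose f k := `[< U k (1 : O) >].
have fA a : a \in support x -> f (src a) = f (tgt a).
  rewrite inE => xa; apply/asboolP/asboolP => U1.
    case: (UorW (tgt a)) => // W1; case/eqP: xa.
    have := Umap a _ U1; rewrite /= /scalar_map mulr1 => Ux.
    by apply: (UW (tgt a)).2 => //; rewrite -[x a]mulr1; exact: WZ.
  case: (UorW (src a)) => // W1; case/eqP: xa.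
  have := Wmap a _ W1; rewrite /= /scalar_map mulr1 => Wx.
  by apply: (UW (tgt a)).2 => //; rewrite -[x a]mulr1; exact: UZ.
have fE := connected_by_const xconn fA.
case: (UorW i) => [U1|W1].
  have Uj : U j (1 : O) by apply/asboolP; rewrite -/(f j) (fE j i); exact/asboolP.
  case/eqP: w0; apply: (UW j).2 => //.
  by rewrite -[w]mulr1; exact: (UZ j w 1).
by case/eqP: u0; apply: (UW i).2 => //; rewrite -[u]mulr1; exact: (WZ i u 1).
Qed.

(** A cut of the vertices that no nonzero arrow crosses splits the
    representation. *)
Lemma connected_indecomposable : (0 < #|vertex Q|)%N ->
  indecomposable (std_rep x) -> connected_by (support x).
Proof.
move=> V0 xind; apply: contraT => /(not_connected_cut V0)[S [[i iS] [j jS] SA]].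
exfalso; apply: xind.
(* part true lives on the vertices of S, part false on the others. *)
pose part (b : bool) (k : vertex Q) : set (qspace (std_rep x) k) :=
  fun v => (k \in S) != b -> v = 0.
have part_sub b : subrep (part b).
  split=> [k|a v pv].
    by split=> // c u w pu pw h; rewrite pu // pw // scaler0 addr0.
  move=> h; rewrite /= /scalar_map; case: (eqVneq (x a) 0) => [->|xa].
    exact: mul0r.
  by rewrite pv ?mulr0 // SA // inE.
exists (part true), (part false); split=> //.
- exists i, (1 : O); split; last exact: oner_neq0.
  by rewrite /part /= iS.
- exists j, (1 : O); split; last exact: oner_neq0.
  by rewrite /part /= (negPf jS).
move=> k; split=> [v|v] /=; rewrite /part /=.
  case: (k \in S); first by exists v, 0; split=> //; rewrite addr0.
  by exists 0, v; split=> //; rewrite add0r.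
by case: (k \in S) => [_|+ _]; apply.
Qed.

End Indecomposable.

Section AbsolutelyIndecomposable.
Variables (F : finFieldType) (N : nat).

Lemma trunc_ext_eq0 (y : trunc F N.+1) : (trunc_ext y == 0) = (y == 0).
Proof.
apply/eqP/eqP => [y0|->]; last exact: raddf0.
apply: truncP => k kN; apply: (fmorph_inj (to_closure F)).
rewrite coef_trunc0 rmorph0 -coef_map -[RHS](coef_trunc0 _ N k) -y0.
by rewrite coef_in_trunc kN.
Qed.

(** Connectedness of the support does not see the extension of the field, so
    indecomposable and absolutely indecomposable coincide in rank (1, ..., 1). *)
Lemma abs_indecomposableP (Q : quiver) (x : {ffun arrow Q -> trunc F N.+1}) :
  (0 < #|vertex Q|)%N ->
  `[< abs_indecomposable x >] = connected_by (support x).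
Proof.
move=> V0.
have -> : support x = support (fun a => trunc_ext (x a)).
  by apply: eq_finset => a; rewrite trunc_ext_eq0.
apply/asboolP/idP; first exact: connected_indecomposable.
exact: indecomposable_connected.
Qed.

End AbsolutelyIndecomposable.

(** * The moment map and endomorphisms *)

(** A bilinear form between finite vector spaces has left and right kernels of
    the same codimension: both are computed from the number of pairs where the
    form is nonzero, because each of its partial forms is zero or
    equidistributed. Only the translations by multiples of a fixed vector enter,
    so the vector space structure is given by the maps tU and tV, where
    tU c u0 u stands for u + c u0. *)
Lemma card_kernels (F : finFieldType) (U V : finType) (b : U -> V -> F)
    (tU : F -> U -> U -> U) (tV : F -> V -> V -> V) :
  (forall c u0, injective (tU c u0)) ->
  (forall c v0, injective (tV c v0)) ->
  (forall c u0 u v, b (tU c u0 u) v = b u v + c * b u0 v) ->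
  (forall c v0 u v, b u (tV c v0 v) = b u v + c * b u v0) ->
  (#|V| * #|[set u | [forall v, (b u v == 0)%R]]| =
   #|U| * #|[set v | [forall u, (b u v == 0)%R]]|)%N.
Proof.
move=> tU_inj tV_inj btU btV.
have count (T T' : finType) (f : T -> T' -> F) (t : F -> T' -> T' -> T') :
    (forall c v0, injective (t c v0)) ->
    (forall c v0 u v, f u (t c v0 v) = f u v + c * f u v0) ->
    (#|F| * \sum_u \sum_v (f u v != 0)%R =
     #|F|.-1 * (#|T'| * (#|T| - #|[set u | [forall v, (f u v == 0)%R]]|)))%N.
  move=> t_inj ft.
  have -> : (#|T| - #|[set u | [forall v, (f u v == 0)%R]]| =
             #|~: [set u | [forall v, (f u v == 0)%R]]|)%N.
    by rewrite -(cardsC [set u | [forall v, (f u v == 0)%R]]) addKn.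
  rewrite [(#|T'| * _)%N]mulnC -sum_nat_const !big_distrr /=.
  rewrite [RHS]big_mkcond /=; apply: eq_bigr => u _; rewrite !inE.
  have -> : (\sum_v (f u v != 0)%R = #|[set v | (f u v != 0)%R]|)%N.
    rewrite -sum1dep_card [RHS]big_mkcond; apply: eq_bigr => v _.
    by case: (_ == _).
  case: forallP => [fu0|fu].
    rewrite (_ : [set v | _] = finset.set0) ?cards0 ?muln0 //.
    by apply/setP => v; rewrite !inE (eqP (fu0 v)) eqxx.
  have {fu} /existsP[v0 fv0] : [exists v, f u v != 0].
    by rewrite -negb_forall; apply/forallP.
  rewrite -[#|T'|]cardsT.
  rewrite -(@card_residue_neq0 F T' [set: T'] (f u)
             (fun c => t (c / f u v0) v0)) //.
  - by congr (_ * _)%N; apply: eq_card => v; rewrite !inE.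
  - by move=> c v _; rewrite ft divfK.
have F1 : (0 < #|F|.-1)%N by rewrite -subn1 subn_gt0 finNzRing_gt1.
have := count U V b tV tV_inj btV.
have := count V U (fun v u => b u v) tU tU_inj (fun c u0 v u => btU c u0 u v).
rewrite exchange_big /= => -> /eqP; rewrite eqn_pmul2l //.
rewrite !mulnBr [(#|U| * #|V|)%N]mulnC => /eqP e.
set L := #|[set u | _]|; set R := #|[set v | _]|.
have Lle : (#|V| * L <= #|V| * #|U|)%N by rewrite leq_mul2l max_card orbT.
have Rle : (#|U| * R <= #|V| * #|U|)%N by rewrite mulnC leq_mul2r max_card orbT.
by rewrite -(subKn Lle) -[in RHS](subKn Rle) e.
Qed.

Section Duality.
Variables (F : finFieldType) (N : nat) (Q : quiver).
Local Notation O := (trunc F N.+1).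
Local Notation V := (vertex Q).
Local Notation A := (arrow Q).
Implicit Types (x y : {ffun A -> O}) (l : {ffun V -> O}).

(** Endomorphisms of the representation x: an endomorphism multiplies by a
    scalar l i at the vertex i. *)
Definition endo x : {set {ffun V -> O}} :=
  [set l : {ffun V -> O} | [forall a, x a * (l (tgt a) - l (src a)) == 0]].

(** This linear form makes the ring a Frobenius algebra: the pairing
    (c, z) |-> top_coef (c * z) is nondegenerate. *)
Definition top_coef (z : O) : F := (val z)`_N.

Lemma top_nondegenerate (z : O) : (forall c, top_coef (c * z) = 0) -> z = 0.
Proof.
move=> z0; apply/eqP; rewrite -ord_eq0; apply: contraT => zN.
have {zN}zN : (ord z < N.+1)%N by rewrite ltn_neqAle zN ord_le.
(* This power of 'X moves the lowest coefficient of z to the top degree. *)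
pose c : O := in_qpoly 'X^(N.+1) 'X^(N - ord z).
have cX : val c = 'X^(N - ord z) :> {poly F}.
  apply/polyP => k; rewrite coef_in_trunc coefXn; case: ltnP => // Nk.
  by rewrite gtn_eqF // (leq_ltn_trans (leq_subr _ _)).
have := coef_ord zN; have := z0 c; rewrite /top_coef coef_truncM // cX coefXnM.
by rewrite ltnNge leq_subr /= subKn // => ->; rewrite eqxx.
Qed.

(** Summation by parts: the moment map and the coboundary map on vertex
    functions are adjoint. *)
Lemma sum_boundary (z : A -> O) l :
  \sum_a z a * (l (tgt a) - l (src a)) =
  \sum_i l i * (\sum_(a | tgt a == i) z a - \sum_(a | src a == i) z a).
Proof.
have side (f : A -> V) :
    \sum_a z a * l (f a) = \sum_i l i * \sum_(a | f a == i) z a.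
  rewrite (partition_big f predT) //=; apply: eq_bigr => i _.
  by rewrite mulr_sumr; apply: eq_bigr => a /eqP <-; rewrite mulrC.
under [LHS]eq_bigr do rewrite mulrBr.
under [RHS]eq_bigr do rewrite mulrBr.
by rewrite !sumrB !side.
Qed.

Definition moment_fiber x : {set {ffun A -> O}} :=
  [set y : {ffun A -> O} | [forall i, \sum_(a | tgt a == i) x a * y a
               - \sum_(a | src a == i) y a * x a == 0]].

(** The moment map equation over x and the endomorphisms of x are the two kernels
    of the pairing (l, y) |-> top_coef (sum_a x_a y_a (l_t(a) - l_s(a))). *)
Lemma card_moment_fiber x :
  (#|O| ^ #|A| * #|endo x| = #|O| ^ #|V| * #|moment_fiber x|)%N.
Proof.
pose b l y := top_coef (\sum_a x a * y a * (l (tgt a) - l (src a))).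
have topD z z' : top_coef (z + z') = top_coef z + top_coef z' by rewrite /top_coef coef_truncD.
have topZ c z : top_coef (trunc_const N c * z) = c * top_coef z.
  rewrite /top_coef coef_truncM // coefM big_ord_recl subn0 coef_trunc_const /=.
  by rewrite big1 ?addr0 // => i _; rewrite coef_trunc_const mul0r.
have top0 : top_coef 0 = 0 by rewrite /top_coef coef_trunc0.
pose t (T : finType) c (f0 f : {ffun T -> O}) : {ffun T -> O} :=
  [ffun i => f i + trunc_const N c * f0 i].
have t_inj (T : finType) c (f0 : {ffun T -> O}) : injective (t T c f0).
  by move=> f f' /ffunP e; apply/ffunP => i; have := e i; rewrite !ffunE => /addIr.
have srcC (y : {ffun A -> O}) i :
    \sum_(a | src a == i) x a * y a = \sum_(a | src a == i) y a * x a.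
  by apply: eq_bigr => a _; rewrite mulrC.
have fiberE : moment_fiber x = [set y | [forall l, b l y == 0]].
  apply/setP => y; rewrite !inE; apply/forallP/forallP => [ym l|yb i].
    rewrite /b sum_boundary big1 ?top0 // => i _; rewrite -[RHS](mulr0 (l i)).
    by congr (_ * _); rewrite -[RHS](eqP (ym i)) srcC.
  apply/eqP/top_nondegenerate => c.
  have /eqP := yb [ffun j => if j == i then c else 0].
  rewrite /b sum_boundary (bigD1 i) //= ffunE eqxx srcC [X in top_coef (_ + X)]big1 ?addr0 //.
  by move=> j /negPf ji; rewrite ffunE ji mul0r.
have endoE : endo x = [set l | [forall y, b l y == 0]].
  apply/setP => l; rewrite !inE; apply/forallP/forallP => [lx y|lb a].
    rewrite /b big1 ?top0 // => a _.
    by rewrite mulrAC (eqP (lx a)) mul0r.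
  apply/eqP/top_nondegenerate => c.
  have /eqP := lb [ffun a' => if a' == a then c else 0].
  rewrite /b (bigD1 a) //= ffunE eqxx big1 ?addr0.
    by rewrite -mulrA mulrCA.
  by move=> a' /negPf aa; rewrite ffunE aa mulr0 mul0r.
rewrite endoE fiberE -!card_ffun; apply: (card_kernels (tU := t V) (tV := t A)).
- exact: t_inj.
- exact: t_inj.
- move=> c l0 l y; rewrite /b -topZ -topD mulr_sumr -big_split /=.
  by congr top_coef; apply: eq_bigr => a _; rewrite !ffunE; ring.
- move=> c y0 l y; rewrite /b -topZ -topD mulr_sumr -big_split /=.
  by congr top_coef; apply: eq_bigr => a _; rewrite !ffunE; ring.
Qed.

Lemma card_moment_zero :
  (#|O| ^ #|V| * #|moment_zero Q F N.+1| = #|O| ^ #|A| * \sum_x #|endo x|)%N.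
Proof.
rewrite big_distrr /=.
under [RHS]eq_bigr do rewrite card_moment_fiber.
rewrite -big_distrr /=; congr (_ * _)%N.
pose g (z : {ffun A -> O * O}) : {ffun A -> O} := [ffun a => (z a).1].
rewrite -sum1_card (partition_big g predT) //=; apply: eq_bigr => x _.
rewrite sum1dep_card.
pose h (z : {ffun A -> O * O}) : {ffun A -> O} := [ffun a => (z a).2].
rewrite -(card_in_imset (f := h)).
  congr #|pred_of_set _|; apply/setP => y; apply/imsetP/idP => [[z]|].
    rewrite inE => /andP[/[!inE] /forallP zm /eqP <-] ->.
    apply/forallP => i; rewrite -[X in _ == X](eqP (zm i)).
    by apply/eqP; congr (_ - _); apply: eq_bigr => a _; rewrite !ffunE.
  rewrite inE => /forallP ym; exists [ffun a => (x a, y a)]; last first.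
    by apply/ffunP => a; rewrite !ffunE.
  rewrite !inE; apply/andP; split; last by apply/eqP/ffunP => a; rewrite !ffunE.
  apply/forallP => i; rewrite -[X in _ == X](eqP (ym i)).
  by apply/eqP; congr (_ - _); apply: eq_bigr => a _; rewrite !ffunE.
move=> z z'; rewrite !inE => /andP[_ /eqP <-] /andP[_ /eqP /ffunP gz] /ffunP hz.
apply/ffunP => a; have := gz a; have := hz a; rewrite !ffunE.
by case: (z a) (z' a) => ? ? [? ?] /= -> ->.
Qed.

End Duality.

(** * Counting isomorphism classes *)

Section IsomorphismClasses.
Variables (F : finFieldType) (N : nat) (Q : quiver).
Local Notation O := (trunc F N.+1).
Local Notation V := (vertex Q).
Local Notation A := (arrow Q).
Implicit Types (x y z : {ffun A -> O}) (g h l : {ffun V -> O}).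

Definition gauge : {set {ffun V -> O}} := [set g : {ffun V -> O} | [forall i, residue (g i) != 0]].

Lemma card_gauge : #|gauge| = ((#|F|.-1 * #|F| ^ N) ^ #|V|)%N.
Proof.
rewrite -card_trunc_unit -card_ffun_on; apply: eq_card => g; rewrite inE.
apply/forallP/ffun_onP => gu i; first by rewrite inE.
by have := gu i; rewrite inE.
Qed.

Lemma gauge_inv g : g \in gauge -> exists2 g', g' \in gauge & forall i, g' i * g i = 1.
Proof.
rewrite inE => /forallP gu.
have [g' g'P] := fin_all_exists (fun i => trunc_inv (gu i)).
exists [ffun i => g' i] => [|i]; last by rewrite ffunE mulrC.
rewrite inE; apply/forallP => i; rewrite ffunE.
have : residue (g i) * residue (g' i) != 0.
  by rewrite -residueM g'P /residue coef_trunc1 oner_neq0.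
by rewrite mulf_eq0 negb_or => /andP[].
Qed.

(** Isomorphisms from x to y, as changes of basis at each vertex. *)
Definition isos x y : {set {ffun V -> O}} :=
  [set g in gauge | [forall a, g (tgt a) * x a == y a * g (src a)]].

Lemma isosP x y g :
  reflect (g \in gauge /\ forall a, g (tgt a) * x a = y a * g (src a)) (g \in isos x y).
Proof.
apply: (iffP setIdP) => -[gG gxy]; split=> //.
  by move=> a; apply/eqP; have /forallP := gxy.
by apply/forallP => a; apply/eqP.
Qed.

Definition gmul g h : {ffun V -> O} := [ffun i => g i * h i].

Lemma isos_mul x y z g h : g \in isos x y -> h \in isos y z -> gmul h g \in isos x z.
Proof.
move=> /isosP[gG gxy] /isosP[hG hyz]; apply/isosP; split=> [|a].
  move: gG hG; rewrite !inE => /forallP gu /forallP hu; apply/forallP => i.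
  by rewrite ffunE residueM mulf_neq0.
by rewrite !ffunE -mulrA gxy mulrA hyz; ring.
Qed.

Lemma isos_inv x y g : g \in isos x y ->
  exists2 g', g' \in isos y x & forall i, g' i * g i = 1.
Proof.
move=> /isosP[gG gxy]; have [g' g'G g'g] := gauge_inv gG.
exists g' => //; apply/isosP; split=> // a.
rewrite -[y a]mulr1 -(g'g (src a)).
have -> : g' (tgt a) * (y a * (g' (src a) * g (src a))) =
          g' (tgt a) * (y a * g (src a)) * g' (src a) by ring.
by rewrite -gxy mulrA g'g mul1r.
Qed.

Lemma isos_refl x : [ffun=> 1] \in isos x x.
Proof.
apply/isosP; split=> [|a]; last by rewrite !ffunE mulrC.
by rewrite inE; apply/forallP => i; rewrite ffunE /residue coef_trunc1 oner_neq0.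
Qed.

(** The isomorphisms from x to y form a torsor under the automorphisms of y. *)
Lemma card_isos x y : isos x y != finset.set0 -> #|isos x y| = #|isos y y|.
Proof.
case/set0Pn => g gxy; have [g' g'yx g'g] := isos_inv gxy.
have inj (k k' : {ffun V -> O}) : (forall i, k' i * k i = 1) -> injective (gmul^~ k).
  move=> kk h h' /ffunP e; apply/ffunP => i; have := e i; rewrite !ffunE => {}e.
  by rewrite -[h i]mulr1 -[h' i]mulr1 -(kk i) ![_ * (k' i * _)]mulrCA e.
apply/eqP; rewrite eqn_leq; apply/andP; split.
  rewrite -(card_imset _ (inj g' g _)); last by move=> i; rewrite mulrC.
  apply/subset_leq_card/fintype.subsetP => _ /imsetP[h hxy ->].
  exact: isos_mul hxy.
rewrite -(card_imset _ (inj g g' g'g)).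
apply/subset_leq_card/fintype.subsetP => _ /imsetP[h hyy ->].
exact: isos_mul hyy.
Qed.

(** Each change of basis is an isomorphism from x to exactly one y. *)
Lemma sum_isos x : (\sum_y #|isos x y| = #|gauge|)%N.
Proof.
have imgP g : {y : {ffun A -> O} | g \in gauge -> forall a, g (tgt a) * x a = y a * g (src a)}.
  apply: cid; case gG: (g \in gauge); last by exists x.
  have [g' _ g'g] := gauge_inv gG.
  exists [ffun a => g (tgt a) * x a * g' (src a)] => _ a.
  by rewrite ffunE -mulrA g'g mulr1.
pose img g := sval (imgP g).
rewrite -[RHS]sum1_card (partition_big img predT) //=; apply: eq_bigr => y _.
rewrite -sum1_card; apply: eq_bigl => g.
apply/isosP/andP => [[gG gxy]|[gG /eqP <-]]; split=> //.
  have [g' _ g'g] := gauge_inv gG; apply/eqP/ffunP => a.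
  rewrite -[LHS]mulr1 -[RHS]mulr1 -(g'g (src a)) ![_ * (g' _ * _)]mulrCA.
  by rewrite -gxy (svalP (imgP g)).
exact: (svalP (imgP g)).
Qed.

Lemma qrep_isoP x y :
  `[< qrep_iso (std_rep x) (std_rep y) >] = (isos x y != finset.set0).
Proof.
apply/asboolP/set0Pn => [[g [gbij gxy]]|[g /isosP[gG gxy]]].
  have gE i (c : O) : g i c = c * g i (1 : O).
    have : g i (c *: (1 : O^o)) = c *: g i (1 : O^o) by rewrite linearZ.
    by rewrite [c *: (1 : O^o)]mulr1.
  exists [ffun i => g i (1 : O)]; apply/isosP; split=> [|a]; last first.
    have := gxy a (1 : O); rewrite /= /scalar_map mulr1 gE !ffunE => <-.
    exact: mulrC.
  rewrite inE; apply/forallP => i; rewrite ffunE; have [g' _ gg'] := gbij i.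
  have : residue (g' (1 : O) * g i (1 : O)) != 0.
    by rewrite -gE gg' /residue coef_trunc1 oner_neq0.
  by rewrite residueM mulf_eq0 negb_or => /andP[].
have [g' _ g'g] := gauge_inv gG.
exists (fun i => scalar_map (g i)); split=> [i|a v] /=.
  exists (scalar_map (g' i)) => v; rewrite /scalar_map mulrA ?g'g ?mul1r //.
  by rewrite [g i * _]mulrC g'g mul1r.
by rewrite /scalar_map !mulrA gxy.
Qed.

Lemma isos_support x y : isos x y != finset.set0 -> support x = support y.
Proof.
case/set0Pn => g /isosP[gG gxy].
have [h _ hg] := gauge_inv gG.
have yx0 a : y a = 0 -> x a = 0.
  move=> ya; rewrite -[x a]mul1r -(hg (tgt a)) -mulrA gxy ya.
  by rewrite mul0r mulr0.
have xy0 a : x a = 0 -> y a = 0.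
  move=> xa; rewrite -[y a]mulr1 -(hg (src a)) mulrCA -gxy xa.
  by rewrite !mulr0.
by apply/setP => a; rewrite !inE; congr (~~ _); apply/eqP/eqP; auto.
Qed.

Lemma isosE x : isos x x = [set l in endo x | [forall i, residue (l i) != 0]].
Proof.
apply/setP => g; rewrite !inE andbC; congr (_ && _); apply: eq_forallb => a.
by rewrite mulrBr subr_eq0 mulrC.
Qed.

(** Along an arrow with x_a != 0, the difference of the values of an
    endomorphism is killed by x_a, hence is not a unit. So an endomorphism of a
    connected x has the same residue at every vertex, it is invertible when this
    residue is nonzero, and adding constants makes the residue equidistributed. *)
Lemma card_isos_connected x : connected_by (support x) ->
  (#|F| * #|isos x x| = #|F|.-1 * #|endo x|)%N.
Proof.
move=> xconn; have /card_gt0P[i0 _] : (0 < #|V|)%N by case/andP: xconn.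
have endo_res l : l \in endo x -> forall i j, residue (l i) = residue (l j).
  move=> lx; apply: (connected_by_const xconn) => a; rewrite inE => xa.
  move: lx; rewrite inE => /forallP/(_ a)/eqP/mul_eq0_ord xl; apply/esym/eqP.
  rewrite -subr_eq0 -coef_truncB coef_lt_ord // -(ltn_add2l (ord (x a))) addn0.
  by apply: leq_trans xl; rewrite ltn_neqAle ord_eq0 xa ord_le.
rewrite isosE.
have -> : [set l in endo x | [forall i, residue (l i) != 0]] =
          [set l in endo x | residue (l i0) != 0].
  apply/setP => l; rewrite !inE; apply: andb_id2l => lx.
  apply/forallP/idP => // l0 i; rewrite (endo_res l _ i i0) //.
  by rewrite inE.
apply: (card_residue_neq0 (tau := fun c l => [ffun i => l i + trunc_const N c])).
- by move=> c l l' /ffunP e; apply/ffunP => i; have := e i; rewrite !ffunE => /addIr.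
- move=> c l; rewrite !inE => /forallP lx; apply/forallP => a.
  by rewrite !ffunE opprD addrACA subrr addr0.
- by move=> c l _; rewrite ffunE residueDC.
Qed.

(** Burnside's count: each isomorphism class contributes #|gauge| to the sum of
    the numbers of automorphisms. *)
Lemma card_kac_count : (0 < #|V|)%N ->
  (#|F| * (kac_count Q F N.+1 * #|gauge|) =
   #|F|.-1 * \sum_(x : {ffun A -> O} | connected_by (support x)) #|endo x|)%N.
Proof.
move=> V0; rewrite /kac_count.
set rel := (fun _ _ => _); set D := [set x | _].
have relE x y : rel x y = (isos x y != finset.set0) by exact: qrep_isoP.
have DE x : x \in D = connected_by (support x).
  by rewrite inE abs_indecomposableP.
have rel_eq : {in D & &, equivalence_rel rel}.
  have sym x y : rel x y -> rel y x.
    rewrite !relE => /set0Pn[g /isos_inv[g' g'yx _]].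
    by apply/set0Pn; exists g'.
  have trans y x z : rel x y -> rel y z -> rel x z.
    rewrite !relE => /set0Pn[g gxy] /set0Pn[h hyz].
    by apply/set0Pn; exists (gmul h g); exact: isos_mul hyz.
  move=> x y z _ _ _; split.
    by rewrite relE; apply/set0Pn; exists [ffun=> 1]; exact: isos_refl.
  move=> xy; apply/idP/idP; last exact: trans.
  by apply: trans; exact: sym.
have /and3P[/eqP covD trivD _] := equivalence_partitionP rel_eq.
have -> : (\sum_(x : {ffun A -> O} | connected_by (support x)) #|endo x| =
           \sum_(x in finset.cover (equivalence_partition rel D)) #|endo x|)%N.
  by rewrite covD; apply: eq_bigl => x; rewrite DE.
rewrite finset.big_trivIset //= mulnCA -sum_nat_const big_distrr /=.
apply: eq_bigr => P /imsetP[x xD ->].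
rewrite -(sum_isos x) big_distrr /= [LHS](bigID (rel x)) /=.
rewrite [X in (_ + X)%N]big1 ?addn0; last first.
  by move=> y; rewrite relE negbK => /eqP ->; rewrite cards0 muln0.
rewrite [RHS]big_distrr /=; apply: eq_big => [y|y xy].
  rewrite inE; case xy: (rel x y); rewrite ?andbF // andbT DE.
  by rewrite -(isos_support (x := x)) -?relE // -DE xD.
rewrite card_isos -?relE // card_isos_connected //.
by rewrite -(isos_support (x := x)) -?relE // -DE.
Qed.

End IsomorphismClasses.

(** * Growth of the number of endomorphisms with the truncation *)

Section Growth.
Variables (F : finFieldType) (Q : quiver).
Local Notation V := (vertex Q).
Local Notation A := (arrow Q).

Definition endo_sum N : nat := (\sum_(x : {ffun A -> trunc F N.+1}) #|endo x|)%N.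

Lemma endo_sumE N : endo_sum N =
  #|[set p : {ffun A -> trunc F N.+1} * {ffun V -> trunc F N.+1} | p.2 \in endo p.1]|.
Proof.
rewrite -sum1dep_card -(pair_big_dep predT (fun x l => l \in endo x) (fun=> fun=> 1%N)) /=.
by apply: eq_bigr => x _; rewrite sum1_card.
Qed.

(** The lift of x to the next truncation with top coefficient c. *)
Definition append_coef N (x : trunc F N.+1) (c : F) : trunc F N.+2 :=
  in_qpoly 'X^(N.+2) (val x + c *: 'X^(N.+1)).

Lemma coef_append N (x : trunc F N.+1) c k :
  (val (append_coef x c))`_k = if k == N.+1 then c else (val x)`_k.
Proof.
rewrite coef_in_trunc coefD coefZ coefXn.
case: (eqVneq k N.+1) => [->|kN]; first by rewrite ltnSn coef_trunc_ge // add0r mulr1.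
rewrite mulr0 addr0; case: ltnP => // Nk.
by rewrite coef_trunc_ge // (leq_trans _ Nk).
Qed.

(** The element c + t l of the next truncation. *)
Definition shift_coef N (c : F) (l : trunc F N.+1) : trunc F N.+2 :=
  in_qpoly 'X^(N.+2) (c%:P + val l * 'X).

Lemma coef_shift N c (l : trunc F N.+1) k :
  (val (shift_coef c l))`_k = if k is k'.+1 then (val l)`_k' else c.
Proof.
rewrite coef_in_trunc coefD coefC coefMX; case: k => [|k] /=.
  by rewrite addr0.
by rewrite add0r ltnS; case: ltnP => // Nk; rewrite coef_trunc_ge.
Qed.

Lemma append_mul_shift N (x l l' : trunc F N.+1) e c : x * (l - l') = 0 ->
  append_coef x e * (shift_coef c l - shift_coef c l') = 0.
Proof.
move=> xl.
have -> : shift_coef c l - shift_coef c l' = shift_coef 0 (l - l').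
  apply: truncP => -[|k] _; rewrite coef_truncB (coef_shift c l) (coef_shift c l')
    (coef_shift 0).
    exact: subrr.
  exact/esym/coef_truncB.
have := coef_append x e; have := coef_shift 0 (l - l').
move: (append_coef x e) (shift_coef 0 (l - l')) => p s sE pE.
apply: truncP => k kN; rewrite coef_truncM // coef_trunc0 coefM big_ord_recr /=.
rewrite subnn sE mulr0 addr0; case: k kN => [|k] kN; first by rewrite big_ord0.
rewrite -[RHS](coef_trunc0 _ N k) -xl coef_truncM // coefM.
apply: eq_bigr => i _; rewrite pE sE.
by rewrite ltn_eqF ?(leq_trans (ltn_ord i)) // subSn // -ltnS.
Qed.

Hypothesis V_gt0 : (0 < #|V|)%N.

(** From an endomorphism l of x one level below, every lift of x has the
    endomorphisms c + t l, since x (l_t - l_s) = 0 gives x t (l_t - l_s) = 0 one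
    level up. There are #|F| choices of lift per arrow, and #|F| choices of c. *)
Lemma endo_sum_leS N : (#|F| ^ #|A|.+1 * endo_sum N <= endo_sum N.+1)%N.
Proof.
have /card_gt0P[i0 _] := V_gt0.
rewrite !endo_sumE expnS.
set P := [set p | _]; set P' := [set p | _].
have -> : (#|F| * #|F| ^ #|A| * #|P| =
           #|finset.setX [set: F * {ffun A -> F}] P|)%N.
  by rewrite cardsX cardsT card_prod card_ffun.
pose f (p : (F * {ffun A -> F}) *
            ({ffun A -> trunc F N.+1} * {ffun V -> trunc F N.+1})) :
    {ffun A -> trunc F N.+2} * {ffun V -> trunc F N.+2} :=
  ([ffun a => append_coef (p.2.1 a) (p.1.2 a)],
   [ffun i => shift_coef p.1.1 (p.2.2 i)]).
have f_inj : injective f.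
  move=> [[c e] [x l]] [[c' e'] [x' l']] [] /ffunP fx /ffunP fl.
  have coefx a k : (if k == N.+1 then e a else (val (x a))`_k) =
                   (if k == N.+1 then e' a else (val (x' a))`_k).
    by have := fx a; rewrite !ffunE /= -!coef_append => ->.
  have coefl i k : (if k is k'.+1 then (val (l i))`_k' else c) =
                   (if k is k'.+1 then (val (l' i))`_k' else c').
    by have := fl i; rewrite !ffunE /= -!coef_shift => ->.
  congr ((_, _), (_, _)).
  - exact: (coefl i0 0%N).
  - by apply/ffunP => a; have := coefx a N.+1; rewrite eqxx.
  - apply/ffunP => a; apply: truncP => k kN; have := coefx a k.
    by rewrite ltn_eqF.
  - by apply/ffunP => i; apply: truncP => k _; have := coefl i k.+1.
rewrite -(card_imset _ f_inj); apply/subset_leq_card/fintype.subsetP.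
move=> _ /imsetP[[[c e] [x l]] /[!inE] /= /forallP xl ->].
apply/forallP => a; rewrite !ffunE append_mul_shift //.
exact/eqP.
Qed.

End Growth.

Section UpperBound.
Variables (F : finFieldType) (N : nat) (Q : quiver).
Local Notation O := (trunc F N.+1).
Local Notation V := (vertex Q).
Local Notation A := (arrow Q).
Implicit Types x : {ffun A -> O}.

(** When B connects the vertices, an endomorphism is determined by its value at
    one vertex and its differences along the arrows of B, which lie in the
    annihilators of the x_a. *)
Lemma card_endo_le x (B : {set A}) : connected_by B ->
  (#|endo x| <= #|F| ^ N.+1 * \prod_(a in B) #|F| ^ ord (x a))%N.
Proof.
move=> Bconn; have /card_gt0P[i0 _] : (0 < #|V|)%N by case/andP: Bconn.
pose D a := if a \in B then ann (x a) else [set 0].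
pose f (l : {ffun V -> O}) : O * {ffun A -> O} :=
  (l i0, [ffun a => if a \in B then l (tgt a) - l (src a) else 0]).
have f_inj : injective f.
  move=> l l' [l0 /ffunP fl]; apply/ffunP => i.
  suff : l i - l' i = l i0 - l' i0 by rewrite l0 subrr => /eqP; rewrite subr_eq0 => /eqP.
  apply: (connected_by_const (f := fun i => l i - l' i) Bconn) => a aB.
  have := fl a; rewrite !ffunE aB => e.
  by rewrite -[l (tgt a)](subrK (l (src a))) e; ring.
rewrite -[#|endo x|](card_imset _ f_inj) -card_trunc.
have -> : (#|{: O}| * \prod_(a in B) #|F| ^ ord (x a) =
           #|{: O}| * \prod_a (if a \in B then #|F| ^ ord (x a) else 1))%N.
  by rewrite big_mkcond.
apply: (@leq_trans #|finset.setX [set: O] [set d in family D]|).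
  apply/subset_leq_card/fintype.subsetP => _ /imsetP[l /[!inE] /forallP lx ->].
  apply/familyP => a; rewrite /D ffunE; case: ifP => _; rewrite !inE //.
rewrite cardsX cardsT leq_mul2l; apply/orP; right.
rewrite cardsE card_family foldrE big_map big_enum /=; apply: leq_prod => a _.
by rewrite /D; case: ifP => _; rewrite ?card_ann ?cards1.
Qed.

End UpperBound.

(** * Domination by a product of geometric series *)

Lemma bernoulli_ineq (R : realFieldType) (d : R) k : 0 <= d <= 1 ->
  1 - k%:R * d <= (1 - d) ^+ k.
Proof.
move=> /andP[d0 d1]; elim: k => [|k IHk]; first by rewrite mul0r subr0 expr0.
have k0 : 0 <= k%:R :> R by rewrite ler0n.
rewrite exprS; apply: le_trans (ler_wpM2l _ IHk); last by rewrite subr_ge0.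
by rewrite -natr1; nra.
Qed.

(** An explicit substitute for a k-th root of 1/2, given by Bernoulli's
    inequality. *)
Lemma near_one_root (R : realFieldType) k :
  exists r : R, [/\ 0 < r, r < 1 & 2^-1 <= r ^+ k].
Proof.
pose d : R := (2 * k.+1%:R)^-1.
have k1 : 1 <= k.+1%:R :> R by rewrite ler1n.
have d0 : 0 < d by rewrite invr_gt0 mulr_gt0 ?ltr0n.
have dk : k.+1%:R * d = 2^-1 by rewrite /d invfM mulrCA divff ?mulr1 ?pnatr_eq0.
exists (1 - d); split; [by nra|by rewrite gtrBl|].
have d01 : 0 <= d <= 1 by rewrite ltW //=; nra.
apply: le_trans (bernoulli_ineq k d01).
by move: dk; rewrite -natr1 => dk; nra.
Qed.

Section RealBound.
Variables (R : realFieldType) (F : finFieldType) (Q : quiver).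
Hypothesis Q2 : two_connected Q.
Local Notation V := (vertex Q).
Local Notation A := (arrow Q).
Local Notation q := (#|F|%:R : R).
Variable r : R.
Hypotheses (r0 : 0 < r) (r1 : r < 1) (qr : q^-1 <= r ^+ #|A|.+1).

Let q0 : 0 < q.
Proof. by rewrite ltr0n; apply/card_gt0P; exists 0. Qed.

Let q_ge0 : 0 <= q. Proof. exact: ltW. Qed.
Let r_ge0 : 0 <= r. Proof. exact: ltW. Qed.

(** There are at most q ^ (N + 1 - j) elements of valuation j, which leaves the
    geometric series of r. *)
Lemma sum_weight N :
  \sum_(x : trunc F N.+1) (q * r) ^+ ord x <= q ^+ N.+1 * (1 - r)^-1.
Proof.
rewrite (partition_big (fun x => inord (ord x) : 'I_N.+2) predT) //=.
apply: (@le_trans _ _ (\sum_(j < N.+2) q ^+ N.+1 * r ^+ j)).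
  apply: ler_sum => j _.
  have jx (x : trunc F N.+1) : (inord (ord x) == j) = (ord x == j).
    by rewrite -val_eqE /= inordK // ltnS ord_le.
  rewrite (eq_bigl _ _ jx) (eq_bigr (fun=> (q * r) ^+ j)); last by move=> x /eqP ->.
  rewrite sumr_const -[leLHS]mulr_natl exprMn mulrA ler_wpM2r ?exprn_ge0 //.
  have -> : q ^+ N.+1 = q ^+ (N.+1 - j) * q ^+ j by rewrite -exprD subnK // -ltnS.
  rewrite ler_wpM2r ?exprn_ge0 // -natrX ler_nat.
  apply: leq_trans (card_ord_ge F N j); apply/subset_leq_card/fintype.subsetP => x.
  by rewrite !inE => /eqP ->.
rewrite -mulr_sumr ler_wpM2l ?exprn_ge0 //.
rewrite -[leRHS]mul1r ler_pdivlMr ?subr_gt0 // mulrC.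
by rewrite -opprB mulNr -subrX1 opprB gerBl exprn_ge0.
Qed.

Section FixedLevel.
Variable N : nat.
Local Notation O := (trunc F N.+1).
Implicit Types x : {ffun A -> O}.

(** Deleting the arrow a0 keeps the graph connected, so card_endo_le saves the
    factor q ^ M at a0, where M = ord (x a0). The choice of r gives
    1 <= q ^ M * r ^ (M * (#|A| + 1)), and as M is the largest valuation this
    spreads the saving over all the arrows, one factor r ^ M being kept. *)
Lemma card_endo_le_max x a0 : (forall a, (ord (x a) <= ord (x a0))%N) ->
  #|endo x|%:R <= q ^+ N.+1 * r ^+ ord (x a0) * \prod_a (q * r) ^+ ord (x a).
Proof.
move=> xmax; set M := ord (x a0).
have /andP[_ /forallP/(_ a0) conn] := Q2.
have := card_endo_le x conn; rewrite -(ler_nat R) => /le_trans; apply.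
rewrite natrM natrX natr_prod -mulrA ler_wpM2l ?exprn_ge0 //.
under eq_bigr do rewrite natrX.
under [X in _ <= _ * X]eq_bigr do rewrite exprMn.
rewrite big_split /= [X in _ <= _ * (X * _)](bigD1 a0) //= -/M.
rewrite (eq_bigl (fun a => a != a0)); last by move=> a; rewrite !inE.
set P := \prod_(a | _) _.
have P0 : 0 <= P by apply: prodr_ge0 => a _; rewrite exprn_ge0.
have rM : r ^+ (M * #|A|) <= \prod_a r ^+ ord (x a).
  rewrite exprM -prodr_const; apply: ler_prod => a _; rewrite exprn_ge0 //=.
  by apply: ler_wiXn2l; rewrite ?ltW ?xmax.
have qrM : 1 <= r ^+ M * r ^+ (M * #|A|) * q ^+ M.
  rewrite -exprD -mulnS mulnC exprM -exprMn exprn_ege1 //.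
  by rewrite -[leLHS](mulVf (lt0r_neq0 q0)) ler_wpM2r.
rewrite -[leLHS]mul1r [leRHS](_ : _ =
  (r ^+ M * \prod_a r ^+ ord (x a) * q ^+ M) * P); last first.
  by rewrite [in LHS]mulrCA [in LHS]mulrC !mulrA.
rewrite ler_wpM2r // (le_trans qrM) // ler_wpM2r ?exprn_ge0 //.
by rewrite ler_wpM2l ?exprn_ge0.
Qed.

Lemma card_endo_le_weight x :
  #|endo x|%:R <= q ^+ N.+1 * \prod_a (q * r) ^+ ord (x a).
Proof.
have [a _|noA] := pickP (@predT A).
  have [a0 _ xmax] := arg_maxnP (fun a => ord (x a)) (isT : predT a).
  apply: le_trans (card_endo_le_max (fun a => xmax a isT)) _.
  rewrite ler_wpM2r ?prodr_ge0 // => [? _|]; first by rewrite exprn_ge0 ?mulr_ge0.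
  by rewrite ler_piMr ?exprn_ge0 // exprn_ile1 // ltW.
have /andP[conn _] := Q2; have := card_endo_le x conn; rewrite -(ler_nat R).
by rewrite natrM natrX !big1 // => a; have := noA a.
Qed.

(** A disconnected x vanishes at some arrow, where the valuation N + 1 is the
    largest possible. *)
Lemma card_endo_le_disconnected x : ~~ connected_by (support x) ->
  #|endo x|%:R <= q ^+ N.+1 * r ^+ N.+1 * \prod_a (q * r) ^+ ord (x a).
Proof.
have [a0 /eqP xa0 _|noA] := pickP (fun a => x a == 0).
  have o0 : ord (x a0) = N.+1 by apply/eqP; rewrite ord_eq0 xa0.
  have := @card_endo_le_max x a0; rewrite o0; apply => a; exact: ord_le.
case/negP; have /andP[conn _] := Q2.
by rewrite (_ : support x = [set: A]) //; apply/setP => a; rewrite !inE noA.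
Qed.

Lemma sum_prod_weight :
  \sum_(x : {ffun A -> O}) \prod_a (q * r) ^+ ord (x a) <= (q ^+ N.+1 / (1 - r)) ^+ #|A|.
Proof.
rewrite -(bigA_distr_bigA (fun _ (z : O) => (q * r) ^+ ord z)) /= -prodr_const.
apply: ler_prod => a _; rewrite sum_weight andbT sumr_ge0 // => z _.
by rewrite exprn_ge0 ?mulr_ge0.
Qed.

(** The order of magnitude of the sum over x of the number of endomorphisms of x:
    there are q ^ ((N + 1) * #|A|) representations, and each has at least the
    q ^ (N + 1) scalar endomorphisms. *)
Definition normalization : R := q ^+ (N.+1 * #|A|.+1).

Lemma endo_sum_le : (endo_sum F Q N)%:R <= normalization / (1 - r) ^+ #|A|.
Proof.
rewrite /endo_sum natr_sum; apply: le_trans (ler_sum _ (fun x _ => card_endo_le_weight x)) _.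
rewrite -mulr_sumr /normalization mulnS exprD exprM -mulrA -expr_div_n.
by rewrite ler_wpM2l ?exprn_ge0 ?sum_prod_weight.
Qed.

Lemma disconnected_sum_le :
  (\sum_(x : {ffun A -> O} | ~~ connected_by (support x)) #|endo x|)%:R <=
  normalization / (1 - r) ^+ #|A| * r ^+ N.+1.
Proof.
rewrite natr_sum; apply: le_trans (ler_sum _ card_endo_le_disconnected) _.
rewrite -mulr_sumr /normalization mulnS exprD exprM.
rewrite [leRHS](_ : _ = q ^+ N.+1 * r ^+ N.+1 * (q ^+ N.+1 / (1 - r)) ^+ #|A|); last first.
  by rewrite expr_div_n -!mulrA; congr (_ * _); rewrite [RHS]mulrC -mulrA.
rewrite ler_wpM2l ?mulr_ge0 ?exprn_ge0 //; apply: le_trans sum_prod_weight.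
rewrite [leRHS](bigID (fun x : {ffun A -> O} => connected_by (support x))) /=.
rewrite lerDr sumr_ge0 // => x _; apply: prodr_ge0 => a _.
by rewrite exprn_ge0 ?mulr_ge0.
Qed.

End FixedLevel.
End RealBound.

(** * Passage to the limit *)

Lemma exprz_quotient (K : fieldType) (x : K) (e : int) (a b : nat) :
  x != 0 -> e + b%:Z = a%:Z -> x ^ e = x ^+ a / x ^+ b.
Proof.
move=> x0 eab; apply: (mulIf (expf_neq0 b x0)).
by rewrite divfK ?expf_neq0 // -[_ ^+ b]/(x ^ b%:Z) -expfzDr // eab.
Qed.

Lemma euler_form_ones (Q : quiver) :
  @euler_form Q (fun=> 1) (fun=> 1) = #|vertex Q|%:Z - #|arrow Q|%:Z.
Proof.
by rewrite /euler_form !sumr_const !mulr1 !natz.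
Qed.

Section Limits.
Variables (R : realType) (F : finFieldType) (Q : quiver).
Hypothesis Q2 : two_connected Q.
Local Notation V := (vertex Q).
Local Notation A := (arrow Q).
Local Notation q := (#|F|%:R : R).

Let V0 : (0 < #|V|)%N.
Proof. by case/andP: Q2 => /andP[]. Qed.

Let q0 : 0 < q.
Proof. by rewrite ltr0n; apply/card_gt0P; exists 0. Qed.

Let q1 : 1 < q.
Proof. by rewrite ltr1n finNzRing_gt1. Qed.

Definition connected_endo_sum N : nat :=
  (\sum_(x : {ffun A -> trunc F N.+1} | connected_by (support x)) #|endo x|)%N.

Definition endo_density N : R := (endo_sum F Q N)%:R / normalization R F Q N.
Definition connected_density N : R :=
  (connected_endo_sum N)%:R / normalization R F Q N.

Let norm_gt0 N : 0 < normalization R F Q N.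
Proof. exact: exprn_gt0. Qed.

Let q_neq0 : q != 0.
Proof. exact: lt0r_neq0. Qed.

Let u := 1 - q^-1.

Let u_gt0 : 0 < u.
Proof. by rewrite subr_gt0 invf_lt1. Qed.

Lemma B_seqE N : B_seq Q F R N.+1 = endo_density N.
Proof.
have qn0 k : q ^+ k != 0 by rewrite expf_neq0.
have := card_moment_zero F N Q.
rewrite -/(endo_sum F Q N) card_trunc => /(congr1 (fun n : nat => n%:R : R)).
rewrite !natrM !natrX -!exprM => e.
rewrite /B_seq /endo_density /normalization /q_of.
rewrite (@exprz_quotient R q _ (N.+1 * #|V|)
  (N.+1 * #|A| + N.+1 * #|A|.+1) q_neq0); last first.
  by rewrite PoszD !PoszM -[#|A|.+1]addn1 PoszD; ring.
apply: (mulIf (qn0 (N.+1 * #|A| + N.+1 * #|A|.+1)%N)).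
by rewrite [LHS]mulrAC divfK // e exprD [RHS]mulrCA divfK.
Qed.

Lemma A_seqE N : A_seq Q F R N.+1 = u / u ^+ #|V| * connected_density N.
Proof.
have qn0 k : q ^+ k != 0 by rewrite expf_neq0.
have un0 k : u ^+ k != 0 by rewrite expf_neq0 // lt0r_neq0.
have qu : #|F|.-1%:R = q * u :> R.
  by rewrite mulrBr mulr1 divff // -subn1 natrB // ltnW // finNzRing_gt1.
have := @card_kac_count F N Q V0.
rewrite card_gauge -/(connected_endo_sum N) => /(congr1 (fun n : nat => n%:R : R)).
rewrite !natrM natrX natrM natrX qu mulrAC -exprS exprMn -exprM -mulrA => /(mulfI q_neq0).
set k := (kac_count Q F N.+1)%:R; set c := (connected_endo_sum N)%:R => e.
rewrite /A_seq /connected_density /normalization /q_of -/k -/c.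
rewrite (@exprz_quotient R q _ (N.+1 * #|V|) (N.+1 * #|A|.+1) q_neq0); last first.
  by rewrite euler_form_ones !PoszM -[#|A|.+1]addn1 PoszD; ring.
apply: (mulIf (qn0 (N.+1 * #|A|.+1)%N)); apply: (mulIf (un0 #|V|)).
rewrite [X in X * _ = _]mulrAC divfK //.
by rewrite mulrA divfK // [RHS]mulrAC divfK // -e mulrCA mulrA.
Qed.

(** Disconnected representations carry a geometrically small part of the
    density. *)
Lemma endo_density_split : exists C r : R, [/\ 0 <= r, r < 1,
  forall N, endo_density N <= C &
  forall N, 0 <= endo_density N - connected_density N <= C * r ^+ N.+1].
Proof.
have [r [r0 r1 rhalf]] := near_one_root R #|A|.+1.
have qr : q^-1 <= r ^+ #|A|.+1.
  by apply: le_trans rhalf; rewrite lef_pV2 ?posrE // ler_nat finNzRing_gt1.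
exists ((1 - r) ^+ #|A|)^-1, r; split=> // [|N|N]; first exact: ltW.
  by rewrite ler_pdivrMr // mulrC endo_sum_le.
rewrite -mulrBl -natrB; last first.
  by rewrite /endo_sum (bigID (fun x : {ffun A -> _} => connected_by (support x))) leq_addr.
rewrite /endo_sum (bigID (fun x : {ffun A -> _} => connected_by (support x))) addKn.
rewrite divr_ge0 ?ler0n ?(ltW (norm_gt0 _)) //= ler_pdivrMr //.
by rewrite mulrC mulrA disconnected_sum_le.
Qed.

Lemma endo_density_nondecreasing :
  {homo endo_density : n m / (n <= m)%N >-> n <= m}.
Proof.
apply/nondecreasing_seqP => N.
rewrite /endo_density ler_pdivrMr // mulrAC ler_pdivlMr //.
rewrite /normalization [(N.+2 * _)%N]mulSn exprD mulrA ler_wpM2r ?exprn_ge0 ?(ltW q0) //.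
by rewrite mulrC -natrX -natrM ler_nat endo_sum_leS.
Qed.

Lemma densities_cvg : exists2 l : R,
  (endo_density @ \oo --> l)%classic & (connected_density @ \oo --> l)%classic.
Proof.
have [C [r [r0 r1 dC dr]]] := endo_density_split.
have dcvg : cvgn endo_density.
  apply: nondecreasing_is_cvgn; first exact: endo_density_nondecreasing.
  by exists C => _ [N _ <-].
exists (limn endo_density) => //.
have diff0 : ((endo_density \- connected_density) @ \oo --> (0 : R))%classic.
  apply: (@squeeze_cvgr _ _ _ _ (cst 0) (fun N => C * r ^+ N.+1)).
  - by apply: nearW => N; exact: dr.
  - exact: cvg_cst.
  - rewrite -[X in (_ --> X)%classic](mulr0 C); apply: cvgMl_tmp.
    rewrite (cvg_shiftS (fun N => r ^+ N)); apply: cvg_expr.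
    by rewrite ger0_norm.
rewrite -[limn _]subr0.
have -> : connected_density = endo_density \- (endo_density \- connected_density).
  by apply/funext => N /=; rewrite opprB addrC subrK.
exact: cvgB.
Qed.

Lemma A_B_limits : exists l : R,
  (A_seq Q F R @ \oo --> u / u ^+ #|V| * l)%classic /\
  (B_seq Q F R @ \oo --> l)%classic.
Proof.
have [l dl cl] := densities_cvg; exists l; split; rewrite -cvg_shiftS.
  rewrite (_ : [sequence _]_n = (fun N => u / u ^+ #|V| * connected_density N)).
    exact: cvgMl_tmp.
  by apply/funext => N; exact: A_seqE.
rewrite (_ : [sequence _]_n = endo_density) //.
by apply/funext => N; exact: B_seqE.
Qed.

End Limits.

Theorem corollary1p0p2 (R : realType) (F : finFieldType) (Q : quiver)
    (Q_2connected : two_connected Q) :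
  let q : R := #|F|%:R in
  [/\ cvgn (A_seq Q F R), cvgn (B_seq Q F R)
    & B_limit Q F R / (1 - q^-1) ^+ #|vertex Q| = A_limit Q F R / (1 - q^-1)].
Proof.
move=> q; have [l [Al Bl]] := A_B_limits R F Q_2connected.
split; [exact: cvgP Al | exact: cvgP Bl |].
rewrite /B_limit /A_limit (cvg_lim _ Bl) // (cvg_lim _ Al) // -/q.
have u0 : 1 - q^-1 != 0.
  by rewrite subr_eq0 eq_sym invr_eq1 pnatr_eq1 gtn_eqF // finNzRing_gt1.
by rewrite [RHS]mulrAC [X in _ = X * _]mulrAC divff // mul1r mulrC.
Qed.
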